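(* Assume that $\chi^{-1}(a)$ is a primitive $n$-th root of unity for some $n\geq 2$. Then a representative set $\mathcal{S}$ of isomorphism classes of simple objects in $\mathcal{W}'$ can be described as follows. (a) If $I=\langle x^n\rangle$, then $\mathcal{S}=\{V_{\lambda}\mid\lambda\in\widehat{G}\}$. (b) If $I=\langle x^n-\beta(1-a^n)\rangle$ with $\beta\in k^{\times}$, $a^n\neq 1$ and $|\chi|=n$, then $$\mathcal{S}=\left\{V_{\lambda},\ V(\sigma,\beta(1-\sigma(a)^n))\ \middle|\ \lambda\in\widehat{G}\text{ with }\lambda(a)^n=1,\ [\sigma]\in\widehat{G}/\langle\chi\rangle\text{ with }\sigma(a)^n\neq 1\right\}$$ (one $\sigma$ being chosen in each class $[\sigma]$).
   Context: $k$ is a field, $G$ a group, $\widehat{G}$ the group of characters $G\to k^{\times}$, $\chi\in\widehat{G}$ of order $|\chi|$ (possibly $\infty$), and $a\in Z(G)$ with $\chi(a)\neq 1$. $H=kG(\chi^{-1},a,0)$ is the Hopf algebra generated as an algebra by $G$ and $x$ with relations $xg=\chi^{-1}(g)gx$ ($g\in G$), having $k$-basis $\{gx^i\mid g\in G,i\geq 0\}$, with $\Delta(x)=x\otimes a+1\otimes x$, $\varepsilon(x)=0$, $S(x)=-xa^{-1}$, and each $g\in G$ group-like. $\langle\chi\rangle$ is the subgroup of $\widehat{G}$ generated by $\chi$ and $[\sigma]$ is the class of $\sigma$ in $\widehat{G}/\langle\chi\rangle$. $H'=H/I$ is a rank one pointed quotient Hopf algebra of $H$; when $\chi^{-1}(a)$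 is a primitive $n$-th root of unity with $n\geq 2$, the Hopf ideal $I$ is either $\langle x^n\rangle$, or $\langle x^n-\beta(1-a^n)\rangle$ with $\beta\in k^{\times}$, $a^n\neq 1$ and $|\chi|=n$. An $H'$-module is the same as an $H$-module $M$ with $I\cdot M=0$. For an $H$-module $M$ and $\lambda\in\widehat{G}$, $M_{(\lambda)}=\{v\in M\mid g\cdot v=\lambda(g)v\ \forall g\in G\}$; $M$ is a weight module if $M=\bigoplus_{\lambda\in\widehat{G}}M_{(\lambda)}$. $\mathcal{W}'$ is the category of all $H'$-modules that are weight modules. $V_{\lambda}$ ($\lambda\in\widehat{G}$) is the $1$-dimensional module with $g\cdot v=\lambda(g)v$, $x\cdot v=0$. If $|\chi|=s<\infty$, $\lambda\in\widehat{G}$ and $\gamma\in k$, then $V(\lambda,\gamma)$ is the $H$-module with $k$-basis $m_0,\dots,m_{s-1}$ and action $g\cdot m_i=\chi^i(g)\lambda(g)m_i$; $x\cdot m_i=m_{i+1}$ for $0\leq i\leq s-2$; $x\cdot m_{s-1}=\gamma m_0$. *)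

(* Defs.v *)
From HB Require Import structures.
From mathcomp Require Import all_boot all_order all_algebra.
From mathcomp Require Import finmap.
From mathcomp Require Import boolp.
From mathcomp Require Import monalg.

Set Implicit Arguments.
Unset Strict Implicit.
Unset Printing Implicit Defensive.

Import GRing.Theory.
Local Open Scope ring_scope.

Section CharacterGroup.
Variables (k : fieldType) (G : groupType).

(* Multiplicativity and [chi 1 = 1] force the values to be nonzero, so these
   are the group homomorphisms from [G] to the unit group of [k]. *)
Record character := Character {
  char_fun :> G -> k;
  char1 : char_fun 1%g = 1;
  charM : forall g h, char_fun (g * h)%g = char_fun g * char_fun h }.

Lemma character_eq (l m : character) : (forall g, l g = m g) -> l = m.
Proof.
case: l m => [l l1 lM] [m m1 mM] /= /funext e; subst m.
by congr Character; exact: Prop_irrelevance.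
Qed.

Lemma char_neq0 (l : character) g : l g != 0.
Proof.
apply/eqP => l0; have := charM l g g^-1%g.
by rewrite mulgV char1 l0 mul0r => /eqP; rewrite oner_eq0.
Qed.

Fact one_char_M (g h : G) : 1 = 1 * 1 :> k. Proof. by rewrite mulr1. Qed.
Definition one_char := @Character (fun=> 1) erefl one_char_M.

Fact mul_char_1 (l m : character) : l 1%g * m 1%g = 1.
Proof. by rewrite !char1 mulr1. Qed.
Fact mul_char_M (l m : character) g h :
  l (g * h)%g * m (g * h)%g = (l g * m g) * (l h * m h).
Proof. by rewrite !charM mulrACA. Qed.
Definition mul_char l m := Character (mul_char_1 l m) (mul_char_M l m).

Fact inv_char_1 (l : character) : (l 1%g)^-1 = 1.
Proof. by rewrite char1 invr1. Qed.
Fact inv_char_M (l : character) g h : (l (g * h)%g)^-1 = (l g)^-1 * (l h)^-1.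
Proof. by rewrite charM invfM. Qed.
Definition inv_char l := Character (inv_char_1 l) (inv_char_M l).

Fact mul_charA : associative mul_char.
Proof. by move=> l m p; apply: character_eq => g /=; rewrite mulrA. Qed.
Fact mul_1char : left_id one_char mul_char.
Proof. by move=> l; apply: character_eq => g /=; rewrite mul1r. Qed.
Fact mul_char1 : right_id one_char mul_char.
Proof. by move=> l; apply: character_eq => g /=; rewrite mulr1. Qed.
Fact mul_Vchar : left_inverse one_char inv_char mul_char.
Proof. by move=> l; apply: character_eq => g /=; rewrite mulVf ?char_neq0. Qed.
Fact mul_charV : right_inverse one_char inv_char mul_char.
Proof. by move=> l; apply: character_eq => g /=; rewrite divff ?char_neq0. Qed.

HB.instance Definition _ := gen_eqMixin character.
HB.instance Definition _ := gen_choiceMixin character.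
HB.instance Definition _ := isGroup.Build character
  mul_charA mul_1char mul_char1 mul_Vchar mul_charV.

Lemma char_mulE (l m : character) g : (l * m)%g g = l g * m g.
Proof. by []. Qed.

Lemma char_invE (l : character) g : (l^-1)%g g = (l g)^-1.
Proof. by []. Qed.

Lemma char_expE (l : character) i g : (l ^+ i)%g g = l g ^+ i.
Proof.
by elim: i => [|i IHi] //; rewrite expgS exprS char_mulE IHi.
Qed.

End CharacterGroup.

Section CyclicSubgroup.
Variable A : groupType.

Definition in_cycle (x y : A) : Prop :=
  exists i : nat, y = (x ^+ i)%g \/ y = (x ^- i)%g.

Definition has_order (x : A) (s : nat) : Prop :=
  [/\ (0 < s)%N, (x ^+ s = 1)%g
    & forall i : nat, (0 < i < s)%N -> (x ^+ i)%g <> 1%g].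

Variable x : A.

Definition cycle_rel (y z : A) : bool := `[< in_cycle x (y^-1 * z)%g >].

Fact in_cycleV y : in_cycle x y -> in_cycle x y^-1%g.
Proof. by case=> i [] ->; exists i; [right | left; rewrite invgK]. Qed.

Fact in_cycleM y z : in_cycle x y -> in_cycle x z -> in_cycle x (y * z)%g.
Proof.
have aux i j : in_cycle x (x ^+ i * x ^- j)%g.
  case: (leqP j i) => [le|/ltnW le].
    by exists (i - j)%N; left; rewrite expgnFr.
  by exists (j - i)%N; right; rewrite expgnFr // invgF.
have cXV i j : commute (x ^+ i)%g (x ^- j)%g.
  by apply/commuteV/commuteX2.
case=> i [] -> [j [] ->].
- by exists (i + j)%N; left; rewrite expgnDr.
- exact: aux.
- by rewrite -cXV; exact: aux.
- by exists (j + i)%N; right; rewrite expgnDr invgM.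
Qed.

Fact cycle_rel_equiv : equiv_class_of cycle_rel.
Proof.
split=> [y|y z|z y t].
- by apply/asboolP; rewrite mulVg; exists 0%N; left.
- by apply/asboolP/asboolP => /in_cycleV; rewrite invgM invgK.
- move=> /asboolP yz /asboolP zt; apply/asboolP.
  by have := in_cycleM yz zt; rewrite mulgA mulgK.
Qed.
Canonical cycle_equiv := EquivRelPack cycle_rel_equiv.

Definition cycle_quot := {eq_quot cycle_equiv}%qT.
HB.instance Definition _ := EqQuotient.on cycle_quot.
HB.instance Definition _ := Choice.on cycle_quot.

Lemma cycle_quotP (y z : A) :
  \pi_(cycle_quot)%qT y = \pi_(cycle_quot)%qT z <-> in_cycle x (y^-1 * z)%g.
Proof.
by split=> [/(@eqmodP _ cycle_equiv)/asboolP // | h];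
  apply/(@eqmodP _ cycle_equiv)/asboolP.
Qed.

End CyclicSubgroup.

Section LinearExtension.
Variables (k : fieldType) (B : choiceType).

Lemma malgUZ (c : k) (b : B) : << c *g b >> = c *: << b >> :> {malg k[B]}.
Proof. by apply/malgP => b'; rewrite mcoeffZ !mcoeffU mulrnAr mulr1. Qed.

Lemma malg_linear_eq (V : lmodType k) (f h : {malg k[B]} -> V) :
  linear f -> linear h -> (forall b, f << b >> = h << b >>) -> f =1 h.
Proof.
move=> lf lh e u.
pose fm := GRing.isLinear.Build k {malg k[B]} V *:%R f lf.
pose hm := GRing.isLinear.Build k {malg k[B]} V *:%R h lh.
pose F : {linear {malg k[B]} -> V} := HB.pack f fm.
pose H : {linear {malg k[B]} -> V} := HB.pack h hm.
rewrite -[f]/(F : _ -> _) -[h]/(H : _ -> _) [u]monalgE !linear_sum.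
by apply: eq_bigr => b _; rewrite malgUZ !linearZ_LR /= e.
Qed.

Variable V : lmodType k.

Definition lin_ext (f : B -> V) (u : {malg k[B]}) : V :=
  \sum_(b <- msupp u) u@_b *: f b.

Lemma lin_extEw (d : {fset B}) f u : (msupp u `<=` d)%fset ->
  lin_ext f u = \sum_(b <- d) u@_b *: f b.
Proof.
move=> le; apply: big_fset_incl => // b _ /mcoeff_outdom ->.
by rewrite scale0r.
Qed.

Lemma lin_ext_linear f : linear (lin_ext f).
Proof.
move=> c u v; pose d := (msupp (c *: u + v) `|` (msupp u `|` msupp v))%fset.
have [le1 le2 le3] : [/\ msupp (c *: u + v) `<=` d, msupp u `<=` d
  & msupp v `<=` d]%fset.
  by split; apply/fsubsetP => b bin; rewrite !inE bin ?orbT.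
rewrite (lin_extEw _ le1) (lin_extEw _ le2) (lin_extEw _ le3) scaler_sumr.
rewrite -big_split; apply: eq_bigr => b _ /=.
by rewrite mcoeffD mcoeffZ scalerDl scalerA.
Qed.

Lemma lin_extU f b : lin_ext f << b >> = f b.
Proof. by rewrite /lin_ext msuppU oner_eq0 big_seq_fset1 mcoeffUU scale1r. Qed.

Lemma lin_ext_param_linear (W : lmodType k) (f : W -> B -> V) u :
  (forall b, linear (f^~ b)) -> linear (fun w => lin_ext (f w) u).
Proof.
move=> lf c v w; rewrite /lin_ext scaler_sumr -big_split.
by apply: eq_bigr => b _ /=; rewrite lf scalerDr !scalerA mulrC.
Qed.

End LinearExtension.

Section Algebra.
Variables (k : fieldType) (G : groupType) (chi : character k G).

(* The algebra kG(chi^-1, a, 0), realized on its basis: [<< (g, i) >>] stands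
   for g x^i.  As an algebra it does not depend on [a]. *)
Definition kGx (_ : character k G) : Type := {malg k[(G * nat)%type]}.
Local Notation H := (kGx chi).
HB.instance Definition _ := GRing.Lmodule.on H.

Implicit Types u v w : H.

Fact kGx_linear_eq (V : lmodType k) (f h : H -> V) :
  linear f -> linear h -> (forall b, f (<< b >> : H) = h (<< b >> : H)) ->
  f =1 h.
Proof. exact: malg_linear_eq. Qed.

(* g x^i h x^j = chi^-1(h)^i g h x^(i+j), since x h = chi^-1(h) h x. *)
Definition kGx_bmul (b c : G * nat) : H :=
  ((chi^-1)%g c.1 ^+ b.2) *: << ((b.1 * c.1)%g, (b.2 + c.2)%N) >>.

Definition kGx_mul u v : H :=
  lin_ext (fun b => lin_ext (kGx_bmul b) v) u.

Definition kGx_one : H := << (1%g, 0%N) >>.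

Fact kGx_mul_linearl v : linear (kGx_mul^~ v).
Proof. exact: lin_ext_linear. Qed.

Fact kGx_mul_linearr u : linear (kGx_mul u).
Proof.
apply: (@lin_ext_param_linear _ _ H H
  (fun v b => lin_ext (kGx_bmul b) v)) => b.
exact: lin_ext_linear.
Qed.

Fact kGx_mulUU b c : kGx_mul << b >> << c >> = kGx_bmul b c.
Proof. by rewrite /kGx_mul !lin_extU. Qed.

Fact kGx_mulA : associative kGx_mul.
Proof.
move=> u v w.
have Lr u' := kGx_mul_linearr u'; have Ll v' := kGx_mul_linearl v'.
have Zr u' e x : kGx_mul u' (e *: x) = e *: kGx_mul u' x.
  exact: (scalable_linear (Lr u')).
have Zl u' e x : kGx_mul (e *: x) u' = e *: kGx_mul x u'.
  exact: (scalable_linear (Ll u')).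
suff /(_ u) : (fun z : H => kGx_mul z (kGx_mul v w))
    =1 (fun z : H => kGx_mul (kGx_mul z v) w) by [].
apply: kGx_linear_eq => [||b]; [exact: Ll | by move=> c x y; rewrite !Ll |].
suff /(_ v) : (fun z : H => kGx_mul (<< b >> : H) (kGx_mul z w))
    =1 (fun z : H => kGx_mul (kGx_mul (<< b >> : H) z) w) by [].
apply: kGx_linear_eq => [||c]; [by move=> e x y; rewrite Ll !Lr
  | by move=> e x y; rewrite Lr !Ll |].
suff /(_ w) : (fun z : H => kGx_mul (<< b >> : H) (kGx_mul (<< c >> : H) z))
    =1 (fun z : H => kGx_mul (kGx_mul (<< b >> : H) (<< c >> : H)) z) by [].
apply: kGx_linear_eq => [||d]; [by move=> e x y; rewrite !Lr | exact: Lr |].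
rewrite !kGx_mulUU /kGx_bmul Zr Zl !kGx_mulUU /kGx_bmul /= !scalerA.
rewrite charM mulgA addnA invfM exprMn exprD; congr (_ *: _).
by rewrite mulrC -!mulrA.
Qed.

Fact kGx_mul1l : left_id kGx_one kGx_mul.
Proof.
apply: kGx_linear_eq => // [|[g i]]; first exact: kGx_mul_linearr.
by rewrite kGx_mulUU /kGx_bmul /= expr0 scale1r mul1g add0n.
Qed.

Fact kGx_mul1r : right_id kGx_one kGx_mul.
Proof.
apply: kGx_linear_eq => // [|[g i]]; first exact: kGx_mul_linearl.
by rewrite kGx_mulUU /kGx_bmul /= char1 invr1 expr1n scale1r mulg1 addn0.
Qed.

Fact kGx_mulDl : left_distributive kGx_mul +%R.
Proof.
by move=> u v w; rewrite -[u]scale1r kGx_mul_linearl !scale1r.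
Qed.

Fact kGx_mulDr : right_distributive kGx_mul +%R.
Proof.
by move=> u v w; rewrite -[v]scale1r kGx_mul_linearr !scale1r.
Qed.

Fact kGx_one_neq0 : kGx_one != 0.
Proof. by rewrite monalgU_eq0 oner_eq0. Qed.

HB.instance Definition _ := GRing.Zmodule_isNzRing.Build H
  kGx_mulA kGx_mul1l kGx_mul1r kGx_mulDl kGx_mulDr kGx_one_neq0.

Fact kGx_scaleAl (c : k) u v : c *: (u * v) = (c *: u) * v.
Proof. exact/esym/(scalable_linear (@kGx_mul_linearl v)). Qed.
HB.instance Definition _ := GRing.Lmodule_isLalgebra.Build k H kGx_scaleAl.

Fact kGx_scaleAr (c : k) u v : c *: (u * v) = u * (c *: v).
Proof. exact/esym/(scalable_linear (@kGx_mul_linearr u)). Qed.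
HB.instance Definition _ := GRing.Lalgebra_isAlgebra.Build k H kGx_scaleAr.

Definition kGx_grp (g : G) : H := << (g, 0%N) >>.
Definition kGx_x : H := << (1%g, 1%N) >>.

Lemma kGx_mulE b c : (<< b >> : H) * (<< c >> : H) = kGx_bmul b c.
Proof. exact: kGx_mulUU. Qed.

Lemma kGx_grp1 : kGx_grp 1%g = 1.
Proof. by []. Qed.

Lemma kGx_grpM g h : kGx_grp (g * h)%g = kGx_grp g * kGx_grp h.
Proof. by rewrite [RHS]kGx_mulUU /kGx_bmul /= expr0 scale1r. Qed.

Lemma kGx_comm g : kGx_x * kGx_grp g = (chi^-1)%g g *: (kGx_grp g * kGx_x).
Proof.
rewrite [X in X = _]kGx_mulUU [X in _ *: X]kGx_mulUU /kGx_bmul /=.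
by rewrite mul1g mulg1 expr1 expr0 scale1r.
Qed.

Lemma kGx_basisE g i : << (g, i) >> = kGx_grp g * kGx_x ^+ i.
Proof.
elim: i => [|i IHi]; first by rewrite expr0 mulr1.
rewrite exprSr mulrA -IHi [RHS]kGx_mulUU /kGx_bmul /=.
by rewrite char1 invr1 expr1n scale1r mulg1 addn1.
Qed.

Definition ideal_gen (r u : H) : Prop :=
  exists s : seq (H * H), u = \sum_(p <- s) p.1 * r * p.2.

End Algebra.

Section Modules.
Variables (k : fieldType) (G : groupType) (chi : character k G).
Local Notation H := (kGx chi).

Definition annihilated (I : H -> Prop) (M : lmodType H) : Prop :=
  forall u : H, I u -> forall v : M, u *: v = 0.

(* Scalars of [k] act on an [H]-module through [c%:A]. *)
Definition weight_space (M : lmodType H) (l : character k G) (v : M) : Prop :=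
  forall g : G, kGx_grp chi g *: v = (l g)%:A *: v.

(* [M] is the direct sum of its weight spaces: every vector is, in a unique
   way, the sum of a finitely supported family of weight vectors. *)
Definition weight_module (M : lmodType H) : Prop :=
  forall v : M, exists! w : {malg M[character k G]},
    (forall l, weight_space l w@_l) /\ v = \sum_(l <- msupp w) w@_l.

(* The (H / I)-modules, viewed as [H]-modules, that are weight modules. *)
Definition weight_cat (I : H -> Prop) (M : lmodType H) : Prop :=
  annihilated I M /\ weight_module M.

Definition iso_mod (M N : lmodType H) : Prop :=
  exists f : {linear M -> N}, bijective f.

(* Simple objects of the full subcategory of [H]-modules with objects [C]:
   nonzero, and every subobject is zero or everything.  Injective morphisms
   stand for monomorphisms, as is right when [C] is closed under submodules. *)
Definition simple_in (C : lmodType H -> Prop) (M : lmodType H) : Prop :=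
  [/\ C M, exists v : M, v <> 0
    & forall (N : lmodType H) (f : {linear N -> M}),
        C N -> injective f -> (forall v : N, v = 0) \/ bijective f].

(* [S] is indexed so that distinct indices give non-isomorphic modules. *)
Definition representative_set (C : lmodType H -> Prop)
    (J : Type) (S : J -> lmodType H) : Prop :=
  [/\ forall j, simple_in C (S j),
      forall M, simple_in C M -> exists j, iso_mod M (S j)
    & forall i j, iso_mod (S i) (S j) -> i = j].

End Modules.

(* A [kGx chi]-module, given by the action of its generators on a [k]-space. *)
Record kGx_action (k : fieldType) (G : groupType) (chi : character k G)
    (V : lmodType k) := KGxAction {
  act_grp : G -> {linear V -> V};
  act_x : {linear V -> V};
  act_grp1 : forall v, act_grp 1%g v = v;
  act_grpM : forall g h v, act_grp (g * h)%g v = act_grp g (act_grp h v);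
  act_comm : forall g v,
    act_x (act_grp g v) = (chi^-1)%g g *: act_grp g (act_x v) }.

Section ModuleOfAction.
Variables (k : fieldType) (G : groupType) (chi : character k G).
Variables (V : lmodType k) (r : kGx_action chi V).
Local Notation H := (kGx chi).

Definition act_mod (_ : kGx_action chi V) : Type := V.
Local Notation M := (act_mod r).
HB.instance Definition _ := GRing.Zmodule.on M.

Definition act_basis (v : V) (b : G * nat) : V :=
  act_grp r b.1 (iter b.2 (act_x r) v).

Definition act_scale (u : H) (v : M) : M := lin_ext (act_basis v) u.

Fact act_basis_linear b : linear (act_basis^~ b).
Proof.
move=> c v w; rewrite /act_basis.
have -> : iter b.2 (act_x r) (c *: v + w) =
    c *: iter b.2 (act_x r) v + iter b.2 (act_x r) w.
  by elim: b.2 => //= i ->; rewrite linearP.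
by rewrite linearP.
Qed.

Fact act_scale_linearl v : linear (act_scale^~ v : H -> V).
Proof. exact: lin_ext_linear. Qed.

Fact act_scale_linearr u : linear (act_scale u : V -> V).
Proof.
by apply: (@lin_ext_param_linear _ _ V V act_basis) => b; exact: act_basis_linear.
Qed.

Fact act_xn_grp i g v : iter i (act_x r) (act_grp r g v) =
  (chi^-1)%g g ^+ i *: act_grp r g (iter i (act_x r) v).
Proof.
elim: i => [|i IHi] /=; first by rewrite expr0 scale1r.
by rewrite IHi linearZ /= act_comm scalerA -exprSr.
Qed.

Fact act_scaleA u v (m : M) : act_scale u (act_scale v m) = act_scale (u * v) m.
Proof.
have Lr u' := act_scale_linearr u'; have Ll m' := act_scale_linearl m'.
suff /(_ u) : (fun z : H => act_scale z (act_scale v m) : V)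
    =1 (fun z : H => act_scale (z * v) m : V) by [].
apply: kGx_linear_eq => [||b]; first exact: Ll.
  by move=> c x y; rewrite mulrDl -scalerAl Ll.
suff /(_ v) : (fun z : H => act_scale (<< b >> : H) (act_scale z m) : V)
    =1 (fun z : H => act_scale ((<< b >> : H) * z) m : V) by [].
apply: kGx_linear_eq => [||c].
- by move=> c x y; rewrite Ll Lr.
- by move=> c x y; rewrite mulrDr -scalerAr Ll.
rewrite kGx_mulE /kGx_bmul (scalable_linear (Ll m)) /act_scale !lin_extU.
by rewrite /act_basis /= act_grpM iterD act_xn_grp linearZ.
Qed.

Fact act_scale1 : left_id 1 act_scale.
Proof. by move=> v; rewrite /act_scale lin_extU /act_basis /= act_grp1. Qed.

Fact act_scaleDr : right_distributive act_scale +%R.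
Proof.
move=> u v w; have := act_scale_linearr u 1 v w.
by rewrite !scale1r.
Qed.

Fact act_scaleDl v : {morph act_scale^~ v : u w / u + w}.
Proof.
move=> u w; have := act_scale_linearl v 1 u w.
by rewrite !scale1r.
Qed.

HB.instance Definition _ := GRing.Zmodule_isLmodule.Build H M
  act_scaleA act_scale1 act_scaleDr act_scaleDl.

Lemma act_modZ (c : k) (v : M) : (c%:A : H) *: v = (c *: (v : V) : V).
Proof.
rewrite [LHS](scalable_linear (act_scale_linearl v)).
by rewrite /= [act_scale 1 v]act_scale1.
Qed.

Lemma act_mod_grp g (v : M) : kGx_grp chi g *: v = act_grp r g v.
Proof. by rewrite [LHS]lin_extU. Qed.

Lemma act_mod_x (v : M) : kGx_x chi *: v = act_x r v.
Proof. by rewrite [LHS]lin_extU /act_basis /= act_grp1. Qed.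

End ModuleOfAction.

Section SimpleModules.
Variables (k : fieldType) (G : groupType) (chi : character k G).
Local Notation H := (kGx chi).

Section OneDimensional.
Variable l : character k G.

Definition V1_grp (g : G) : {linear k^o -> k^o} := *:%R (l g).

Fact V1_grp1 v : V1_grp 1%g v = v.
Proof. by rewrite /= char1 scale1r. Qed.
Fact V1_grpM g h v : V1_grp (g * h)%g v = V1_grp g (V1_grp h v).
Proof. by rewrite /= charM scalerA. Qed.
Fact V1_comm g (v : k^o) : (\0 : {linear k^o -> k^o}) (V1_grp g v) =
  (chi^-1)%g g *: V1_grp g ((\0 : {linear k^o -> k^o}) v).
Proof. by rewrite /= !scaler0. Qed.

Definition V1_action := KGxAction V1_grp1 V1_grpM V1_comm.

(* The one-dimensional module V_l *)
Definition V1 : lmodType H := act_mod V1_action.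

End OneDimensional.

Section Cyclic.
Variables (s : nat) (chi_s : has_order chi s).
Variables (l : character k G) (c : k).

(* Matrices act on row vectors on the right: row i is the image of m_i. *)
Definition Vs_grp_mx (g : G) : 'M[k]_s := diag_mx (\row_i (chi g ^+ i * l g)).
Definition Vs_x_mx : 'M[k]_s := \matrix_(i, j)
  (if (i.+1 < s)%N then (j == i.+1 :> nat)%:R else c *+ (j == 0 :> nat)).

Definition Vs_grp (g : G) : {linear 'rV[k]_s -> 'rV[k]_s} :=
  mulmxr (Vs_grp_mx g).
Definition Vs_x : {linear 'rV[k]_s -> 'rV[k]_s} := mulmxr Vs_x_mx.

Fact Vs_grp1 v : Vs_grp 1%g v = v.
Proof.
apply/rowP => j; rewrite /= mul_mx_diag !mxE !char1.
by rewrite expr1n !mulr1.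
Qed.

Fact Vs_grpM g h v : Vs_grp (g * h)%g v = Vs_grp g (Vs_grp h v).
Proof.
apply/rowP => j; rewrite /= !mul_mx_diag !mxE !charM exprMn -mulrA.
by congr (_ * _); rewrite [RHS]mulrC mulrACA.
Qed.

Fact Vs_comm g v : Vs_x (Vs_grp g v) = (chi^-1)%g g *: Vs_grp g (Vs_x v).
Proof.
rewrite /= -!mulmxA scalemxAr; congr (_ *m _); apply/matrixP => i j.
rewrite mul_diag_mx mul_mx_diag !mxE -/(char_fun _ _).
have [s_gt0 chis _] := chi_s.
have chig : chi g ^+ s = 1 by rewrite -char_expE chis.
case: ltnP => [lt_is|le_si].
  case: eqP => [->|_]; last by rewrite mul0r !mulr0.
  by rewrite mulr1 mul1r exprS !mulrA mulVf ?mul1r ?char_neq0.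
case: eqP => [->|_]; last by rewrite mul0r !mulr0.
have es : s = i.+1 by apply/eqP; rewrite eqn_leq le_si ltn_ord.
rewrite expr0 mul1r mulr1n [c * _]mulrC !mulrA; congr (_ * _ * _).
by apply: (mulfI (char_neq0 chi g)); rewrite -exprS -es chig divff ?char_neq0.
Qed.

Definition Vs_action := KGxAction Vs_grp1 Vs_grpM Vs_comm.

(* V(l, c), with basis m_i = [Vs_m i] *)
Definition Vs : lmodType H := act_mod Vs_action.

Definition Vs_m (i : 'I_s) : Vs := (delta_mx 0 i : 'rV[k]_s).

Lemma Vs_grpE g i :
  kGx_grp chi g *: Vs_m i = ((chi g ^+ i * l g)%:A : H) *: Vs_m i.
Proof.
rewrite act_modZ act_mod_grp /= -rowE; apply/rowP => j.
rewrite !mxE eqxx /=; have [->|_] := eqVneq i j; first by rewrite mulr1.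
by rewrite mulr0.
Qed.

Lemma Vs_xE (i j : 'I_s) : j = i.+1 :> nat -> kGx_x chi *: Vs_m i = Vs_m j.
Proof.
move=> ij; rewrite act_mod_x /= -rowE; apply/rowP => t.
by rewrite !mxE -ij ltn_ord eqxx.
Qed.

Lemma Vs_x_last (i j : 'I_s) : i.+1 = s -> j = 0 :> nat ->
  kGx_x chi *: Vs_m i = (c%:A : H) *: Vs_m j.
Proof.
move=> is_s j0; rewrite act_modZ act_mod_x /= -rowE; apply/rowP => t.
by rewrite !mxE is_s ltnn eqxx -val_eqE /= j0 mulr_natr.
Qed.

End Cyclic.
End SimpleModules.

(* Main.v *)
From HB Require Import structures.
Require Import Defs.
From mathcomp Require Import all_boot all_order all_algebra.
From mathcomp Require Import finmap boolp monalg.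

Set Implicit Arguments.
Unset Strict Implicit.
Unset Printing Implicit Defensive.

Import GRing.Theory.
Local Open Scope ring_scope.

(** Both quotients are treated at once, as quotients by the relator
    x^n - beta (1 - a^n): the first one is beta = 0.

    The element x maps the weight space of l to that of chi l, because
    g x = chi(g) x g.  Hence, on a module killed by the relator, x^n acts on the
    weight space of l as the scalar gamma(l) = beta (1 - l(a)^n), and gamma is
    constant on the coset of l modulo the powers of chi, since chi(a)^n = 1.

    A nonzero weight module contains a nonzero weight vector v, of weight l say.
    If gamma(l) = 0, then x is nilpotent on v, and the last nonzero x^i v spans
    a copy of the one-dimensional module of weight chi^i l ([V1_embedding]).
    If gamma(l) <> 0, then every x^i v is nonzero.  When chi has order n, the
    vectors v, x v, ..., x^(n-1) v have distinct weights, hence are linearly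
    independent ([weight_independent]), and they span a copy of
    V(l, gamma(l)) ([Vs_embedding]).  In a simple module the copy is everything.
    Starting from x^i v instead of v replaces l by chi^i l, so any chosen
    representative of the coset of l can be reached, and no isomorphism between
    different V(l, gamma) has to be constructed ([simple_cat_iso]).

    Conversely V(l, gamma) is simple when gamma <> 0: its weights are distinct,
    so a nonzero submodule that is a weight module contains some basis vector
    m_i, and x permutes the lines of the basis vectors cyclically
    ([Vs_simple]).  The modules listed are told apart by their weights and by
    whether x acts as zero. *)

(** * Scalars and linear maps *)

Section WeightModules.
Variables (k : fieldType) (G : groupType) (chi : character k G).
Local Notation H := (kGx chi).
Local Notation x := (kGx_x chi).
Local Notation grp := (kGx_grp chi).
Implicit Types (M N : lmodType H) (l m : character k G) (c : k).

Lemma scale_kGx M c (u : H) (v : M) :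
  (c *: u) *: v = (c%:A : H) *: (u *: v).
Proof. by rewrite scalerA -scalerAl mul1r. Qed.

Lemma scaleCA_kGx M c (u : H) (v : M) :
  u *: ((c%:A : H) *: v) = (c%:A : H) *: (u *: v).
Proof. by rewrite scalerA -scalerAr mulr1 scale_kGx. Qed.

Lemma scaleA_kGx M c d (v : M) :
  (c%:A : H) *: ((d%:A : H) *: v) = ((c * d)%:A : H) *: v.
Proof. by rewrite -scale_kGx scalerA. Qed.

Lemma scale_kGxK M c (v : M) : c != 0 -> (c^-1%:A : H) *: ((c%:A : H) *: v) = v.
Proof. by move=> c0; rewrite scaleA_kGx mulVf // !scale1r. Qed.

Lemma scale_kGx_eq0 M c (v : M) : (c%:A : H) *: v = 0 -> c = 0 \/ v = 0.
Proof.
have [->|c0 cv] := eqVneq c 0; first by left.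
by right; rewrite -[v](scale_kGxK _ c0) cv scaler0.
Qed.

(** The elements g x^i span the algebra over k, so a map commuting with k, with
    the group and with x is linear over the algebra; this is how maps out of the
    standard modules are built. *)
Lemma linear_of_generators M N (f : M -> N) :
  (forall v w, f (v + w) = f v + f w) ->
  (forall c v, f ((c%:A : H) *: v) = (c%:A : H) *: f v) ->
  (forall g v, f (grp g *: v) = grp g *: f v) ->
  (forall v, f (x *: v) = x *: f v) ->
  exists F : {linear M -> N}, F =1 f.
Proof.
move=> fD fZ fg fx.
have f0 : f 0 = 0 by apply: (addrI (f 0)); rewrite -fD !addr0.
have fX i v : f (x ^+ i *: v) = x ^+ i *: f v.
  elim: i v => [|i IHi] v; first by rewrite expr0 !scale1r.
  by rewrite exprS -!scalerA fx IHi.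
have flin : linear f.
  move=> u v w; rewrite fD; congr (_ + _).
  rewrite [u : {malg k[_]}]monalgE !scaler_suml (big_morph f fD f0).
  apply: eq_bigr => [[g i]] _.
  have -> : << u@_(g, i) *g (g, i) >> = u@_(g, i) *: (grp g * x ^+ i) :> H.
    by rewrite -kGx_basisE; exact: malgUZ.
  by rewrite [in LHS]scale_kGx [RHS]scale_kGx fZ -!scalerA fg fX.
pose fm := GRing.isLinear.Build H M N *:%R f flin.
by exists (HB.pack f fm : {linear M -> N}).
Qed.

Lemma surjective_linear_bij M N (f : {linear M -> N}) :
  injective f -> (forall w, exists v, f v = w) -> bijective f.
Proof.
move=> finj fsurj; have [h hK] := choice fsurj.
by exists h => // v; apply: finj; rewrite hK.
Qed.

Lemma iso_mod_sym M N : iso_mod M N -> iso_mod N M.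
Proof.
case=> f [h fK hK]; have hlin : linear h by exact: can2_linear fK hK.
pose hm := GRing.isLinear.Build H N M *:%R h hlin.
by exists (HB.pack h hm : {linear N -> M}); exists f.
Qed.

(** * Weight vectors *)

Lemma weight0 M l : weight_space l (0 : M).
Proof. by move=> g; rewrite !scaler0. Qed.

Lemma weightD M l (v w : M) :
  weight_space l v -> weight_space l w -> weight_space l (v + w).
Proof. by move=> hv hw g; rewrite !scalerDr hv hw. Qed.

Lemma weightB M l (v w : M) :
  weight_space l v -> weight_space l w -> weight_space l (v - w).
Proof. by move=> hv hw g; rewrite !scalerBr hv hw. Qed.

Lemma weightZ M l c (v : M) :
  weight_space l v -> weight_space l ((c%:A : H) *: v).
Proof. by move=> hv g; rewrite scaleCA_kGx hv !scaleA_kGx mulrC. Qed.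

Lemma weight_linear M N (f : {linear M -> N}) l (v : M) :
  weight_space l v -> weight_space l (f v).
Proof. by move=> hv g; rewrite -!linearZ_LR hv. Qed.

(** Because g x = chi(g) x g. *)
Lemma weight_x M l (v : M) :
  weight_space l v -> weight_space (chi * l)%g (x *: v).
Proof.
move=> hv g; have -> : grp g *: (x *: v) = (chi g *: (x * grp g)) *: v.
  rewrite scalerA; congr (_ *: v).
  by rewrite kGx_comm scalerA char_invE divff ?char_neq0 // scale1r.
by rewrite scale_kGx -scalerA hv scaleCA_kGx scaleA_kGx.
Qed.

Lemma weight_xn M l (v : M) i :
  weight_space l v -> weight_space (chi ^+ i * l)%g (x ^+ i *: v).
Proof.
move=> hv; elim: i => [|i IHi]; first by rewrite !scale1r mul1g.
by rewrite exprS -scalerA expgS -mulgA; exact: weight_x.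
Qed.

Lemma weight_eq M l m (v : M) :
  v <> 0 -> weight_space l v -> weight_space m v -> l = m.
Proof.
move=> v0 hl hm; apply: character_eq => g.
have : ((l g - m g)%:A : H) *: v = 0.
  by rewrite scalerBl scalerBl -hl -hm subrr.
by case/scale_kGx_eq0 => // /eqP; rewrite subr_eq0 => /eqP.
Qed.

(** The usual argument for eigenvectors: applying g - (l i)(g) to a relation
    removes its term of index i and multiplies each other term by a scalar that,
    for a suitable g, is nonzero. *)
Lemma weight_independent M (I : eqType) (s : seq I)
    (l : I -> character k G) (w : I -> M) :
  injective l -> uniq s -> (forall i, weight_space (l i) (w i)) ->
  \sum_(i <- s) w i = 0 -> {in s, forall i, w i = 0}.
Proof.
move=> linj; elim: s w => [//|i s IHs] w /= /andP[ns us] hw sw0.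
have hs j : j \in s -> w j = 0.
  move=> js; apply: contrapT => wj0; case/negP: ns.
  suff /linj -> : l i = l j by [].
  apply/esym/(weight_eq wj0 (hw j)) => g; rewrite hw.
  have hw' p : weight_space (l p) (((l p g - l i g)%:A : H) *: w p).
    by apply/weightZ/hw.
  have : \sum_(p <- s) ((l p g - l i g)%:A : H) *: w p = 0.
    have -> : \sum_(p <- s) ((l p g - l i g)%:A : H) *: w p =
        grp g *: \sum_(p <- i :: s) w p - (l i g)%:A *: \sum_(p <- i :: s) w p.
      rewrite !scaler_sumr -sumrB big_cons hw subrr add0r.
      by apply: eq_bigr => p _; rewrite hw !scalerBl.
    by rewrite sw0 !scaler0 subrr.
  move/(IHs _ us hw')/(_ j js).
  by rewrite !scalerBl => /eqP; rewrite subr_eq0 => /eqP.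
move=> j; rewrite inE => /predU1P[->|/hs //].
by move: sw0; rewrite big_cons big_seq big1 // addr0.
Qed.

Definition total M (w : {malg M[character k G]}) : M :=
  \sum_(l <- msupp w) w@_l.

Lemma totalEw M (w : {malg M[character k G]}) (d : {fset character k G}) :
  (msupp w `<=` d)%fset -> total w = \sum_(l <- d) w@_l.
Proof.
by move=> le; apply: big_fset_incl => // l _ /mcoeff_outdom ->.
Qed.

Lemma totalB M (w w' : {malg M[character k G]}) :
  total (w - w') = total w - total w'.
Proof.
have le := msuppB_le w w'.
rewrite (totalEw le) (totalEw (fsubsetUl _ (msupp w'))).
rewrite (totalEw (fsubsetUr (msupp w) _)) -sumrB.
by apply: eq_bigr => l _; rewrite mcoeffB.
Qed.

Lemma total0 M : total (0 : {malg M[character k G]}) = 0.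
Proof. by rewrite -(subrr 0) totalB subrr. Qed.

(** Uniqueness of the weight decomposition is automatic, by independence of
    weight vectors; and sums with repeated weights can be regrouped. *)
Lemma weight_module_of_sums M :
  (forall v : M, exists (I : finType) (w : I -> M) (l : I -> character k G),
     (forall i, weight_space (l i) (w i)) /\ v = \sum_i w i) ->
  weight_module M.
Proof.
move=> sums v; have [I [w [l [hw ->]]]] := sums v.
pose dec (u : M) := exists z : {malg M[character k G]},
  (forall l, weight_space l z@_l) /\ u = total z.
have [z [hz ez]] : dec (\sum_i w i).
  apply: (big_ind dec) => [|u u' [z [hz ->]] [z' [hz' ->]]|i _].
  - exists 0; split=> [m|]; last by rewrite total0.
    by rewrite mcoeff0; exact: weight0.
  - exists (z - (- z')); rewrite totalB; split=> [m|].
      by rewrite opprK mcoeffD; exact: weightD.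
    by rewrite -[- z']add0r totalB total0 sub0r opprK.
  - exists << w i *g l i >>; split=> [m|].
      by rewrite mcoeffU; case: eqP => [<-|_]; [exact: hw | exact: weight0].
    by rewrite (totalEw msuppU_le) big_seq_fset1 mcoeffUU.
exists z; split=> // z' [hz' ez'].
have d0 : total (z - z') = 0 by rewrite totalB -ez [total z'](esym ez') subrr.
apply/malgP => m; apply/eqP; rewrite -subr_eq0 -mcoeffB.
have [mz|/mcoeff_outdom -> //] := boolP (m \in msupp (z - z')).
apply/eqP/(@weight_independent _ _ _ id _ _ (fset_uniq _) _ d0) => // p.
by rewrite mcoeffB; exact: weightB.
Qed.

Lemma weight_module_vector M : weight_module M -> (exists v : M, v <> 0) ->
  exists l (v : M), v <> 0 /\ weight_space l v.
Proof.
move=> wM [v v0]; have [w [[hw ev] _]] := wM v.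
apply: contrapT => no; apply: v0; rewrite ev big1 // => l _.
by apply: contrapT => wl0; apply: no; exists l, w@_l.
Qed.
End WeightModules.

(** * Powers of x and simple objects *)

Section Classification.
Variables (k : fieldType) (G : groupType) (chi : character k G).
Local Notation H := (kGx chi).
Local Notation x := (kGx_x chi).
Local Notation grp := (kGx_grp chi).
Implicit Types (M N : lmodType H) (l m : character k G) (c beta : k).

Lemma annihilated_ideal_gen M (r : H) :
  annihilated (ideal_gen r) M <-> forall v : M, r *: v = 0.
Proof.
split=> [ann v|r0 _ [s ->] v].
  apply: ann; exists [:: (1, 1)].
  by rewrite big_seq1 mul1r mulr1.
rewrite scaler_suml big1 // => p _.
by rewrite -!scalerA r0 scaler0.
Qed.

Lemma scale_xn M n c (v : M) i : x ^+ n *: v = (c%:A : H) *: v ->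
  x ^+ n *: (x ^+ i *: v) = (c%:A : H) *: (x ^+ i *: v).
Proof.
by move=> e; rewrite scalerA -exprD addnC exprD -scalerA e scaleCA_kGx.
Qed.

(** If x^(i+1) v = 0 with i minimal, then c x^i v = x^n x^i v = 0 as n > 0. *)
Lemma scale_xn_neq0 M n c (v : M) i : (0 < n)%N -> c != 0 ->
  x ^+ n *: v = (c%:A : H) *: v -> v <> 0 -> x ^+ i *: v <> 0.
Proof.
move=> n0 c0 e v0; elim: i => [|i IHi]; first by rewrite scale1r.
move=> xi0; apply: IHi.
have : x ^+ n *: (x ^+ i *: v) = 0.
  case: n n0 e => // n _ _; rewrite exprSr -scalerA [x *: _]scalerA -exprS.
  by rewrite xi0 scaler0.
rewrite (scale_xn _ e) => /scale_kGx_eq0[ce|//].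
by rewrite ce eqxx in c0.
Qed.

Lemma last_nonzero_power M n (v : M) : x ^+ n *: v = 0 -> v <> 0 ->
  exists2 i, x ^+ i *: v <> 0 & x *: (x ^+ i *: v) = 0.
Proof.
elim: n => [|n IHn]; first by rewrite scale1r.
move=> xn1 v0; have [xn0|xn] := pselect (x ^+ n *: v = 0); first exact: IHn.
by exists n => //; rewrite scalerA -exprS.
Qed.

Lemma grpX_weight M l (v : M) g n :
  weight_space l v -> grp g ^+ n *: v = ((l g ^+ n)%:A : H) *: v.
Proof.
move=> hv; elim: n => [|n IHn]; first by rewrite !expr0 !scale1r.
by rewrite exprS -scalerA IHn scaleCA_kGx hv scaleA_kGx exprSr.
Qed.

Lemma simple_iso (C : lmodType H -> Prop) M N (f : {linear N -> M}) :
  simple_in C M -> C N -> (exists v : N, v <> 0) -> injective f -> iso_mod M N.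
Proof.
case=> _ _ simpleM CN [v v0] finj; apply: iso_mod_sym.
by case: (simpleM N f CN finj) => [/(_ v)//|fbij]; exists f.
Qed.

(** * The one-dimensional modules *)

Section OneDim.
Variable l : character k G.

Lemma V1_weight (v : V1 chi l) : weight_space l v.
Proof. by move=> g; rewrite act_modZ act_mod_grp. Qed.

Lemma V1_x (v : V1 chi l) : x *: v = 0.
Proof. by rewrite act_mod_x. Qed.

Lemma V1_nonzero : exists v : V1 chi l, v <> 0.
Proof. by exists (1 : k); apply/eqP; exact: oner_neq0. Qed.

Lemma V1_weight_module : weight_module (V1 chi l).
Proof.
apply: weight_module_of_sums => v.
exists unit, (fun=> v), (fun=> l); split=> [_|]; first exact: V1_weight.
by rewrite (big_pred1 tt) // => [[]].
Qed.

Lemma V1_simple (C : lmodType H -> Prop) :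
  C (V1 chi l) -> simple_in C (V1 chi l).
Proof.
move=> CV; split=> // [|N f _ finj]; first exact: V1_nonzero.
have [N0|/existsNP[v v0]] := pselect (forall v : N, v = 0); first by left.
right; apply: surjective_linear_bij => // w.
have fv0 : (f v : k) != 0.
  by apply/eqP => fv0; apply: v0; apply: finj; rewrite fv0 linear0.
exists ((((w : k) / (f v : k))%:A : H) *: v); rewrite linearZ_LR act_modZ.
exact: divfK.
Qed.

Lemma V1_embedding M (v : M) :
  v <> 0 -> weight_space l v -> x *: v = 0 ->
  exists f : {linear V1 chi l -> M}, injective f.
Proof.
move=> v0 hv xv.
have [||||f ef] := @linear_of_generators _ _ _ (V1 chi l) M
    (fun c : V1 chi l => ((c : k)%:A : H) *: v).
- by move=> c d; rewrite -scalerDl -scalerDl.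
- by move=> c d; rewrite act_modZ scaleA_kGx.
- move=> g c; rewrite act_mod_grp scaleCA_kGx hv scaleA_kGx.
  by rewrite /= mulrC.
- by move=> c; rewrite V1_x scaleCA_kGx xv scaler0 !scale0r.
exists f => c d; rewrite !ef => /eqP; rewrite -subr_eq0 -scalerBl -scalerBl.
by move=> /eqP /scale_kGx_eq0[/eqP|//]; rewrite subr_eq0 => /eqP.
Qed.
End OneDim.

Lemma V1_iso_inj l m : iso_mod (V1 chi l) (V1 chi m) -> l = m.
Proof.
case=> f /bij_inj finj; have [v v0] := V1_nonzero l.
have fv0 : f v <> 0 by rewrite -(linear0 f) => /finj.
exact: weight_eq fv0 (weight_linear f (V1_weight v)) (V1_weight (f v)).
Qed.

(** * The cyclic modules *)

Lemma has_order_inj s i j : has_order chi s -> (i < s)%N -> (j < s)%N ->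
  (chi ^+ i = chi ^+ j)%g -> i = j.
Proof.
case=> _ _ chi_min; wlog lt_ij : i j / (i < j)%N => [th si sj e|_ sj e].
  by have [/th|/th th'|//] := ltngtP i j; [exact | apply/esym/th'].
have /chi_min[] : (0 < j - i < s)%N.
  by rewrite subn_gt0 lt_ij (leq_ltn_trans (leq_subr _ _)).
by rewrite expgnFr 1?ltnW // -e mulgV.
Qed.

(** An inverse chi^-i is the nonnegative power chi^(i (s-1)). *)
Lemma in_cycle_exp s m : has_order chi s -> in_cycle chi m ->
  exists j, m = (chi ^+ j)%g.
Proof.
case=> s0 chis _ [i [->|->]]; first by exists i.
exists (i * s.-1)%N; apply: (mulgI (chi ^+ i)%g).
by rewrite mulgV -expgnDr -mulnS prednK // mulnC expgnA chis expg1n.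
Qed.

Section Cyclic.
Variables (s : nat) (chi_s : has_order chi s).

Section FixedParameters.
Variables (l : character k G) (c : k).
Local Notation V := (Vs chi_s l c).
Local Notation e := (Vs_m chi_s l c).

Lemma Vs_sum (w : V) :
  w = \sum_i (((w : 'rV[k]_s) 0 i)%:A : H) *: e i.
Proof.
rewrite [LHS](row_sum_delta (w : 'rV[k]_s)).
by apply: eq_bigr => i _; rewrite act_modZ.
Qed.

Lemma Vs_m_weight (i : 'I_s) : weight_space (chi ^+ i * l)%g (e i).
Proof. by move=> g; rewrite Vs_grpE char_mulE char_expE. Qed.

Lemma Vs_m_neq0 i : e i <> 0.
Proof.
by move/rowP/(_ i)/eqP; rewrite !mxE !eqxx oner_eq0.
Qed.

Lemma Vs_mX (i i0 : 'I_s) : i0 = 0%N :> nat -> e i = x ^+ i *: e i0.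
Proof.
move=> i00; case: i => i /=; elim: i => [|i IHi] lt_is.
  by rewrite scale1r; congr (e _); apply: val_inj.
by rewrite exprS -scalerA -(IHi (ltnW lt_is)); apply/esym/Vs_xE.
Qed.

(** Going once around the cycle of basis vectors multiplies by c; it is enough
    to see this on m_0, since m_i = x^i m_0. *)
Lemma Vs_xs i : x ^+ s *: e i = (c%:A : H) *: e i.
Proof.
have [s0 _ _] := chi_s; pose i0 := Ordinal s0.
have lt_s : (s.-1 < s)%N by rewrite prednK.
rewrite (@Vs_mX i i0) //; apply: scale_xn.
have -> : x ^+ s = x * x ^+ (Ordinal lt_s) by rewrite -exprS prednK.
rewrite -scalerA -(@Vs_mX _ i0) //; apply: Vs_x_last => //=.
by rewrite prednK.
Qed.

Lemma Vs_weight_module : weight_module V.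
Proof.
apply: weight_module_of_sums => w.
exists 'I_s, (fun i => (((w : 'rV[k]_s) 0 i)%:A : H) *: e i).
exists (fun i : 'I_s => chi ^+ i * l)%g; split=> [i|]; last exact: Vs_sum.
exact/weightZ/Vs_m_weight.
Qed.

Lemma exp_chi_mul_inj : injective (fun i : 'I_s => chi ^+ i * l)%g.
Proof.
move=> i j /mulIg eij; apply: val_inj.
exact: has_order_inj chi_s (ltn_ord i) (ltn_ord j) eij.
Qed.

(** The weights of the basis vectors are pairwise distinct, so the nonzero
    weight spaces are the lines that they span. *)
Lemma Vs_weight_vector m (w : V) : w <> 0 -> weight_space m w ->
  exists i : 'I_s, m = (chi ^+ i * l)%g /\
    exists2 d, d != 0 & w = (d%:A : H) *: e i.
Proof.
move=> w0 hw; pose wi i := (w : 'rV[k]_s) 0 i.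
have wtE (i : 'I_s) : wi i != 0 -> m = (chi ^+ i * l)%g.
  move=> wi0; apply: character_eq => g; rewrite char_mulE char_expE.
  apply/esym/(mulIf wi0); have := hw g.
  rewrite act_modZ act_mod_grp => /rowP/(_ i).
  by rewrite /= mul_mx_diag !mxE mulrC.
have [i wi0] : exists i, wi i != 0.
  apply: contrapT => no; apply: w0; rewrite [w]Vs_sum big1 // => i _.
  rewrite -/(wi i).
  have [->|wi0] := eqVneq (wi i) 0; first by rewrite !scale0r.
  by case: no; exists i.
exists i; split; first exact: wtE.
exists (wi i) => //; rewrite {1}[w]Vs_sum (bigD1 i) //=.
rewrite [X in _ + X]big1 ?addr0 //.
move=> j ji; rewrite -/(wi j).
have [->|/wtE ej] := eqVneq (wi j) 0; first by rewrite !scale0r.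
have /exp_chi_mul_inj eji : (chi ^+ j * l = chi ^+ i * l)%g by rewrite -ej -wtE.
by rewrite eji eqxx in ji.
Qed.

(** A weight vector of a nonzero subobject is, up to a nonzero factor, a basis
    vector m_i, and x^(s-i) m_i = c m_0 generates the module. *)
Lemma Vs_simple (C : lmodType H -> Prop) : c != 0 ->
  (forall N, C N -> weight_module N) -> C V -> simple_in C V.
Proof.
have [s0 _ _] := chi_s; pose i0 := Ordinal s0.
move=> c0 CW CV; split=> // [|N f CN finj].
  by exists (e i0); exact: Vs_m_neq0.
have [N0|/existsNP nz] := pselect (forall v : N, v = 0); [by left | right].
have [m [v [v0 hv]]] := weight_module_vector (CW N CN) nz.
have fv0 : f v <> 0 by rewrite -(linear0 f) => /finj.
have [i [_ [d d0 fv]]] := Vs_weight_vector fv0 (weight_linear f hv).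
have [v1 fv1] : exists v1, f v1 = e i0.
  exists ((c^-1%:A : H) *: (x ^+ (s - i) *: ((d^-1%:A : H) *: v))).
  rewrite !linearZ_LR fv scale_kGxK // (@Vs_mX i i0) //.
  by rewrite [x ^+ (s - i) *: _]scalerA -exprD subnK 1?ltnW // Vs_xs scale_kGxK.
apply: surjective_linear_bij => // w.
exists (\sum_i (((w : 'rV[k]_s) 0 i)%:A : H) *: (x ^+ i *: v1)).
rewrite linear_sum [RHS]Vs_sum; apply: eq_bigr => i' _.
by rewrite !linearZ_LR fv1 -Vs_mX.
Qed.

(** The map m_i |-> x^i v.  It commutes with x at the end of the cycle because
    x^s v = c v, and it is injective because the x^i v are nonzero vectors of
    distinct weights. *)
Lemma Vs_embedding M (v : M) : c != 0 -> v <> 0 -> weight_space l v ->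
  x ^+ s *: v = (c%:A : H) *: v -> exists f : {linear V -> M}, injective f.
Proof.
have [s0 _ _] := chi_s; move=> c0 v0 hv xv.
pose F (w : V) : M := \sum_i (((w : 'rV[k]_s) 0 i)%:A : H) *: (x ^+ i *: v).
have FD w w' : F (w + w') = F w + F w'.
  by rewrite -big_split; apply: eq_bigr => i _; rewrite mxE !scalerDl.
have FZ d w : F ((d%:A : H) *: w) = (d%:A : H) *: F w.
  rewrite scaler_sumr; apply: eq_bigr => i _.
  by rewrite act_modZ mxE scaleA_kGx.
have F0 : F 0 = 0 by apply: (addrI (F 0)); rewrite -FD !addr0.
have Fe i : F (e i) = x ^+ i *: v.
  rewrite /F (bigD1 i) //= big1 => [|j ji]; rewrite mxE eqxx ?(negPf ji) /=.
    by rewrite eqxx addr0 !scale1r.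
  by rewrite !scale0r.
have Fsum w : F w = \sum_i (((w : 'rV[k]_s) 0 i)%:A : H) *: F (e i).
  by apply: eq_bigr => i _; rewrite Fe.
have Fgen (u : H) : (forall i, F (u *: e i) = u *: F (e i)) ->
    forall w, F (u *: w) = u *: F w.
  move=> Fu w; rewrite {1}[w]Vs_sum scaler_sumr (big_morph F FD F0).
  rewrite Fsum scaler_sumr.
  by apply: eq_bigr => i _; rewrite !scaleCA_kGx FZ Fu.
have [||||f ef] := @linear_of_generators _ _ _ V M F => //.
- move=> g; apply: Fgen => i.
  by rewrite Fe Vs_m_weight FZ Fe; exact/esym/weight_xn.
- apply: Fgen => i; rewrite Fe scalerA -exprS.
  have [lt_is|le_si] := ltnP i.+1 s.
    by rewrite (@Vs_xE _ _ _ _ _ _ _ i (Ordinal lt_is)) // Fe.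
  have is_s : i.+1 = s by apply/eqP; rewrite eqn_leq le_si ltn_ord.
  by rewrite (@Vs_x_last _ _ _ _ _ _ _ i (Ordinal s0)) // FZ Fe scale1r is_s xv.
exists f => w w' /eqP; rewrite -subr_eq0 -linearB ef => /eqP fww.
apply/eqP; rewrite -subr_eq0; apply/eqP.
rewrite [LHS]Vs_sum big1 // => i _; set d := (_ : 'rV_s) 0 i.
have hd (j : 'I_s) : weight_space (chi ^+ j * l)%g
   ((((w - w' : V) : 'rV[k]_s) 0 j)%:A *: (x ^+ j *: v)).
  exact/weightZ/weight_xn.
have := weight_independent exp_chi_mul_inj (index_enum_uniq _) hd fww.
move/(_ i (mem_index_enum i)) => /scale_kGx_eq0[d0|].
  by rewrite /d d0 !scale0r.
by move/(scale_xn_neq0 s0 c0 xv v0).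
Qed.

(** On the one-dimensional module x acts as zero, but m_1 = x m_0. *)
Lemma V1_Vs_not_iso m : (1 < s)%N -> ~ iso_mod (V1 chi m) V.
Proof.
move=> s1 [f [h _ hK]]; have [s0 _ _] := chi_s.
apply: (@Vs_m_neq0 (Ordinal s1)).
rewrite -(@Vs_xE _ _ _ _ _ _ _ (Ordinal s0) (Ordinal s1)) //.
by rewrite -[e _]hK -linearZ_LR V1_x linear0.
Qed.
End FixedParameters.

(** The image of m_0 is a weight vector of weight l, and the weights of the
    target are the chi^i m. *)
Lemma Vs_iso_in_cycle l m c d : iso_mod (Vs chi_s l c) (Vs chi_s m d) ->
  in_cycle chi (m^-1 * l)%g.
Proof.
have [s0 _ _] := chi_s; case=> f /bij_inj finj.
pose v := Vs_m chi_s l c (Ordinal s0).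
have fv0 : f v <> 0 by rewrite -(linear0 f) => /finj /Vs_m_neq0.
have hv : weight_space l v.
  by have := Vs_m_weight l c (Ordinal s0); rewrite mul1g.
have [i [el _]] := Vs_weight_vector fv0 (weight_linear f hv).
exists i; left; rewrite el; apply: character_eq => g.
by rewrite !char_mulE char_invE mulrC mulfK ?char_neq0.
Qed.
End Cyclic.

(** * Simple weight modules over the quotient *)

Section Quotient.
Variables (a : G) (n : nat) (n_gt0 : (0 < n)%N) (chi_an : chi a ^+ n = 1).
Variable beta : k.

Definition relator : H := x ^+ n - beta *: (1 - grp a ^+ n).

(** The scalar by which x^n acts on vectors of weight l, once the relator acts
    as zero. *)
Definition xn_scalar l : k := beta * (1 - l a ^+ n).

Lemma xn_scalar_coset i l : xn_scalar (chi ^+ i * l)%g = xn_scalar l.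
Proof.
by rewrite /xn_scalar char_mulE char_expE exprMn -exprM mulnC exprM chi_an
  expr1n mul1r.
Qed.

Lemma relator_weight M l (v : M) : weight_space l v ->
  relator *: v = x ^+ n *: v - ((xn_scalar l)%:A : H) *: v.
Proof.
move=> hv; rewrite scalerBl scale_kGx scalerBl scale1r (grpX_weight _ _ hv).
by rewrite -scaleA_kGx [in RHS]scalerBl [in RHS]scalerBl !scale1r.
Qed.

Lemma xn_weight M l (v : M) : annihilated (ideal_gen relator) M ->
  weight_space l v -> x ^+ n *: v = ((xn_scalar l)%:A : H) *: v.
Proof.
move/annihilated_ideal_gen=> r0 hv; apply/eqP.
by rewrite -subr_eq0 -relator_weight ?r0.
Qed.

Lemma V1_simple_cat l : xn_scalar l = 0 ->
  simple_in (weight_cat (ideal_gen relator)) (V1 chi l).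
Proof.
move=> l0; apply: V1_simple; split; last exact: V1_weight_module.
apply/annihilated_ideal_gen => v.
rewrite (relator_weight (V1_weight v)) l0 !scale0r subr0.
by rewrite -(prednK n_gt0) exprSr -scalerA V1_x scaler0.
Qed.

Lemma Vs_simple_cat (chi_n : has_order chi n) l : xn_scalar l != 0 ->
  simple_in (weight_cat (ideal_gen relator)) (Vs chi_n l (xn_scalar l)).
Proof.
move=> l0; apply: Vs_simple => // [N []//|].
split; last exact: Vs_weight_module.
apply/annihilated_ideal_gen => v; rewrite [v]Vs_sum scaler_sumr big1 // => i _.
rewrite scaleCA_kGx (relator_weight (Vs_m_weight chi_n _ _ i)) Vs_xs.
by rewrite xn_scalar_coset subrr scaler0.
Qed.

(** A weight vector v of weight l in M decides.  In the second case the choice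
    of i corresponds to starting from x^i v, which gives every representative of
    the coset of l. *)
Lemma simple_cat_iso M : simple_in (weight_cat (ideal_gen relator)) M ->
  (exists2 l, xn_scalar l = 0 & iso_mod M (V1 chi l)) \/
  exists l, xn_scalar l != 0 /\
    forall (chi_n : has_order chi n) i,
    iso_mod M (Vs chi_n (chi ^+ i * l)%g (xn_scalar (chi ^+ i * l)%g)).
Proof.
move=> sM; have [[annM wM] nzM _] := sM.
have [l [v [v0 hv]]] := weight_module_vector wM nzM.
have xnv := xn_weight annM hv.
have [l0|l0] := eqVneq (xn_scalar l) 0; [left|right].
  have [|i xiv xSiv] := @last_nonzero_power M n v _ v0.
    by rewrite xnv l0 !scale0r.
  have li0 : xn_scalar (chi ^+ i * l)%g = 0 by rewrite xn_scalar_coset.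
  exists (chi ^+ i * l)%g => //.
  have [f finj] := V1_embedding xiv (weight_xn i hv) xSiv.
  have [CV nzV _] := V1_simple_cat li0.
  exact: simple_iso sM CV nzV finj.
exists l; split=> // chi_n i.
have li0 : xn_scalar (chi ^+ i * l)%g != 0 by rewrite xn_scalar_coset.
have xiv := scale_xn_neq0 n_gt0 l0 xnv v0 (i := i).
have hiv := weight_xn i hv.
have [f finj] := Vs_embedding chi_n li0 xiv hiv (xn_weight annM hiv).
have [CV nzV _] := Vs_simple_cat chi_n li0.
exact: simple_iso sM CV nzV finj.
Qed.
End Quotient.
End Classification.

Theorem corollary3p16 (k : fieldType) (G : groupType) (chi : character k G)
    (a : G) (n : nat)
    (a_central : forall g : G, commute a g)
    (chi_a : chi a != 1)
    (n_ge2 : (2 <= n)%N)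
    (chiVa_prim : n.-primitive_root ((chi^-1)%g a)) :
  representative_set
    (weight_cat (ideal_gen (kGx_x chi ^+ n)))
    (fun l : character k G => V1 chi l)
  /\
  forall (beta : k) (chi_n : has_order chi n)
      (r : cycle_quot chi -> character k G),
    beta != 0 ->
    (a ^+ n)%g != 1%g ->
    (forall q, \pi_(cycle_quot chi)%qT (r q) = q) ->
    representative_set
      (weight_cat
        (ideal_gen (kGx_x chi ^+ n - beta *: (1 - kGx_grp chi a ^+ n))))
      (fun j : {l : character k G | l a ^+ n == 1}
               + {q : cycle_quot chi | r q a ^+ n != 1} =>
         match j with
         | inl l => V1 chi (sval l)
         | inr q => Vs chi_n (r (sval q)) (beta * (1 - r (sval q) a ^+ n))
         end).
Proof.
have n_gt0 : (0 < n)%N by exact: ltnW.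
have chi_an : chi a ^+ n = 1.
  by apply: invr_inj; rewrite -exprVn invr1; exact: prim_expr_order chiVa_prim.
split=> [|beta chi_n r beta0 _ rP].
  (* With beta = 0 the scalar of x^n vanishes on every weight. *)
  have relE : kGx_x chi ^+ n = relator chi a n 0.
    by rewrite /relator scale0r subr0.
  have xn0 l : xn_scalar a n 0 l = 0 by exact: mul0r.
  rewrite relE; split=> [l|M sM|l m].
  - exact: V1_simple_cat.
  - have [[l _ ?]|[l []]] := simple_cat_iso n_gt0 chi_an sM; first by exists l.
    by rewrite xn0 eqxx.
  - exact: V1_iso_inj.
have xn_eq0 l : (xn_scalar a n beta l == 0) = (l a ^+ n == 1).
  by rewrite mulf_eq0 (negPf beta0) subr_eq0 eq_sym.
rewrite -/(relator chi a n beta); split=> [[[l hl]|[q hq]]|M sM|].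
- by apply: V1_simple_cat => //; apply/eqP; rewrite xn_eq0.
- by apply: Vs_simple_cat => //; rewrite xn_eq0.
- have [[l l0 Ml]|[l [l0 Ml]]] := simple_cat_iso n_gt0 chi_an sM.
    have hl : l a ^+ n == 1 by rewrite -xn_eq0 l0.
    by exists (inl (exist _ l hl)).
  (* The chosen representative of the coset of l is chi^i l for some i >= 0. *)
  have [i ri] : exists i, r (\pi_(cycle_quot chi)%qT l) = (chi ^+ i * l)%g.
    have /esym/cycle_quotP/(in_cycle_exp chi_n)[i ei] :=
      rP (\pi_(cycle_quot chi)%qT l).
    exists i; rewrite -ei; apply: character_eq => g.
    by rewrite !char_mulE char_invE mulrC mulVKf ?char_neq0.
  have hq : r (\pi_(cycle_quot chi)%qT l) a ^+ n != 1.
    by rewrite -xn_eq0 ri xn_scalar_coset.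
  exists (inr (exist (fun q => is_true (r q a ^+ n != 1)) _ hq)).
  by rewrite /= ri; exact: Ml.
- move=> [[l hl]|[q hq]] [[m hm]|[p hp]] /=.
  + by move/V1_iso_inj => e; congr inl; apply: val_inj.
  + by move/V1_Vs_not_iso.
  + by move/iso_mod_sym/V1_Vs_not_iso.
  + move/Vs_iso_in_cycle/cycle_quotP; rewrite !rP => e.
    by congr inr; apply: val_inj.
Qed.
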